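(* Let $\varepsilon \in (0,1)$, $n_1, n_2, m \in \mathbb{N}$, and $r = \lceil 9 \log(3 n_1 n_2)/\varepsilon^2 \rceil$. Let $f : \mathbb{R}^m \times \mathbb{R}^m \to \mathbb{R}$ be a continuous shift-invariant positive-definite kernel, $f(x,y) = \kappa(x-y)$, with $\kappa(0) = 1$. Then for every matrix $F \in \mathbb{R}^{n_1 \times n_2}$ of the form $F(i,j) = f(x_i, y_j)$ with arbitrary points $\{x_i\}_{i=1}^{n_1}, \{y_j\}_{j=1}^{n_2} \subset \mathbb{R}^m$, there exists $G \in \mathbb{R}^{n_1 \times n_2}$ with $\mathrm{rank}(G) \leq r$ such that $\|F - G\|_{\max} \leq \varepsilon$.
   Context: $\mathbb{N} = \{1,2,\ldots\}$; $\log$ is the natural logarithm. $\|F\|_{\max} = \max_{i,j} |F(i,j)|$. A function $f : \mathbb{R}^m \times \mathbb{R}^m \to \mathbb{R}$ is a positive-definite kernel if $f(x,y) = f(y,x)$ for all $x,y$ and, for each $n \in \mathbb{N}$ and any pairwise distinct points $z_1, \ldots, z_n \in \mathbb{R}^m$, the symmetric matrix $(f(z_i, z_j))_{i,j=1}^n$ is positive-definite. It is shift-invariant if there exists a function $\kappa : \mathbb{R}^m \to \mathbb{R}$ such that $f(x,y) = \kappa(x-y)$ for all $x,y$. *)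

(* Defs.v *)
From mathcomp Require Import all_boot all_order all_algebra.
From mathcomp Require Import all_classical all_reals all_analysis.

Set Implicit Arguments.
Unset Strict Implicit.
Unset Printing Implicit Defensive.

Import Order.TTheory GRing.Theory Num.Theory.
Import numFieldNormedType.Exports.

Local Open Scope ring_scope.

Definition posdefmx (R : realType) (n : nat) (A : 'M[R]_n) : Prop :=
  A^T = A /\ forall u : 'rV[R]_n, u != 0 -> 0 < (u *m A *m u^T) 0 0.

Definition positive_definite_kernel (R : realType) (m : nat)
    (f : 'rV[R]_m -> 'rV[R]_m -> R) : Prop :=
  (forall x y, f x y = f y x) /\
  forall (n : nat) (z : 'I_n -> 'rV[R]_m), (0 < n)%N -> injective z ->
    posdefmx (\matrix_(i < n, j < n) f (z i) (z j)).

Definition shift_invariant_via (R : realType) (m : nat)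
    (f : 'rV[R]_m -> 'rV[R]_m -> R) (kappa : 'rV[R]_m -> R) : Prop :=
  forall x y, f x y = kappa (x - y).

(* Main.v *)
(* Only positive semidefiniteness and the unit diagonal matter: factoring the
   kernel matrix on the finitely many points gives unit vectors u_i, v_j with
   F i j = <u_i, v_j>, and a Johnson-Lindenstrauss argument finishes. For a
   uniform sign vector s, the rank-one matrix <s, u_i><s, v_j> has mean F, and
   its deviation from F i j has exponential moment at most exp(9/4 l^2) for
   |l| <= 2/9. Choosing s_1, ..., s_r greedily so as to control the sum of
   exp(+- l * deviation) over all entries and both signs, with l = 2 eps / 9,
   makes the average of the r rank-one matrices eps-close to F. *)

Require Import Defs.
From mathcomp Require Import all_boot all_order all_algebra.
From mathcomp Require Import all_classical all_reals all_analysis.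
From mathcomp Require Import ring lra.
Import Order.TTheory GRing.Theory Num.Theory.
Import numFieldNormedType.Exports.
Local Open Scope ring_scope.

(** * Elementary inequalities for the exponential *)

Lemma ge0_of_ge0_derive {R : realType} (f df : R -> R) (x : R) :
  0 <= x -> (forall y, is_derive y (1 : R) f (df y)) ->
  (forall y, 0 <= y -> 0 <= df y) -> f 0 <= f x.
Proof.
move=> x0 fdf df0; have cf : {within `[0, x], continuous f}%classic.
  apply: continuous_subspaceT => y.
  by apply/differentiable_continuous/derivable1_diffP; exact: ex_derive.
have [c + fE] := MVT_segment x0 (fun y _ => fdf y) cf.
rewrite in_itv/= => /andP[c0 _].
by rewrite -subr_ge0 fE subr0 mulr_ge0 ?df0.
Qed.

Lemma expR_1B_le_1D {R : realType} (x : R) :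
  0 <= x -> (1 - x) * expR x <= (1 + x) * expR (- x).
Proof.
move=> x0.
pose f (y : R) := (1 + y) * expR (- y) - (1 - y) * expR y.
suff : f 0 <= f x by rewrite /f oppr0 !expR0 !addr0 subrr subr_ge0.
apply: (@ge0_of_ge0_derive _ _ (fun y => y * (expR y - expR (- y)))) => //.
  move=> y; rewrite /f; apply: is_derive_eq.
  by rewrite /GRing.scale/=; ring.
by move=> y y0; rewrite mulr_ge0// subr_ge0 ler_expR; lra.
Qed.

(** By evenness take [0 <= x]. There [f], which is minus twice the quotient of the two sides, is
    nondecreasing: [expR_1B_le_1D] gives the sign of its derivative. *)
Lemma cosh_le_expR {R : realType} (x : R) :
  (expR x + expR (- x)) / 2 <= expR (x ^+ 2 / 2).
Proof.
wlog x0 : x / 0 <= x => [cosh_le|].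
  have [/cosh_le//|/ltW x0] := leP 0 x.
  by have := cosh_le (- x); rewrite oppr_ge0 opprK sqrrN addrC; exact.
pose f (y : R) := - (expR (y - y ^+ 2 / 2) + expR (- y - y ^+ 2 / 2)).
have : f 0 <= f x.
  apply: (@ge0_of_ge0_derive _ _ (fun y =>
    expR (- (y ^+ 2 / 2)) * ((1 + y) * expR (- y) - (1 - y) * expR y))) => //.
    move=> y; rewrite /f; apply: is_derive_eq.
    by rewrite !expRD /GRing.scale/=; field.
  by move=> y y0; rewrite mulr_ge0 ?expR_ge0// subr_ge0 expR_1B_le_1D.
rewrite /f !expRD expr0n/= mul0r oppr0 !expR0 !mulr1 lerN2 -mulrDl.
rewrite [expR (- (_ / 2))]expRN.
by rewrite ler_pdivrMr ?expR_gt0// => ?; lra.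
Qed.

(** * Exponential moments over random signs *)

(** Expectation over a uniform vector of signs, by recursion on coordinates so that induction on the
    dimension averages out one sign at a time. *)
Fixpoint signmean {R : realType} {d : nat} : ('rV[R]_d -> R) -> R :=
  match d with
  | 0 => fun g => g 0
  | d'.+1 => fun g =>
      (signmean (fun s : 'rV[R]_d' => g (row_mx (const_mx 1 : 'rV_1) s)) +
       signmean (fun s : 'rV[R]_d' => g (row_mx (const_mx (-1) : 'rV_1) s))) / 2
  end.

Section SignMean.
Context {R : realType}.
Implicit Type d : nat.

Lemma signmean_le d (g h : 'rV[R]_d -> R) :
  (forall s, g s <= h s) -> signmean g <= signmean h.
Proof.
elim: d g h => [|d IH] g h gh /=; first exact: gh.
by rewrite ler_pM2r ?invr_gt0// lerD// IH.
Qed.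

Lemma eq_signmean d (g h : 'rV[R]_d -> R) :
  (forall s, g s = h s) -> signmean g = signmean h.
Proof. by move=> gh; congr signmean; apply/funext. Qed.

Lemma signmeanD d (g h : 'rV[R]_d -> R) :
  signmean (fun s => g s + h s) = signmean g + signmean h.
Proof. by elim: d g h => [//|d IH] g h /=; rewrite !IH; ring. Qed.

Lemma signmeanZ d a (g : 'rV[R]_d -> R) :
  signmean (fun s => a * g s) = a * signmean g.
Proof. by elim: d g => [//|d IH] g /=; rewrite !IH; ring. Qed.

Lemma signmean_sum d (I : Type) (r : seq I) (g : I -> 'rV[R]_d -> R) :
  signmean (fun s => \sum_(i <- r) g i s) = \sum_(i <- r) signmean (g i).
Proof.
elim: d g => [//|d IH] g /=.
by rewrite !IH -big_split/= mulr_suml.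
Qed.

Lemma signmean_witness d (g : 'rV[R]_d -> R) : exists s, g s <= signmean g.
Proof.
elim: d g => [|d IH] g /=; first by exists 0.
have [s gs] := IH (fun s => g (row_mx (const_mx 1 : 'rV_1) s)).
have [t gt] := IH (fun s => g (row_mx (const_mx (-1) : 'rV_1) s)).
have [st|/ltW ts] := leP (g (row_mx (const_mx 1 : 'rV_1) s))
                         (g (row_mx (const_mx (-1) : 'rV_1) t)).
  by exists (row_mx (const_mx 1 : 'rV_1) s); lra.
by exists (row_mx (const_mx (-1) : 'rV_1) t); lra.
Qed.

(* Averaging out the first sign turns l into k = l + 2 l^2 a^2 by
   cosh x <= exp (x^2 / 2); the constants 2/9 and 9/4 are such that the bound
   survives this step. *)
Lemma signmean_expR_sqr d (w : 'cV[R]_d) (l : R) :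
  `|l| * (\sum_i w i 0 ^+ 2) <= 2 / 9 ->
  signmean (fun s => expR (l * (s *m w) 0 0 ^+ 2)) <=
  expR (l * (\sum_i w i 0 ^+ 2) + 9 / 4 * (l * \sum_i w i 0 ^+ 2) ^+ 2).
Proof.
elim: d w l => [|d IH] w l.
  by rewrite /= big_ord0 mul0mx mxE !mulr0 expr0n/= !mulr0 addr0.
rewrite -[w](@vsubmxK R 1 d 1); set a := @usubmx R 1 d 1 w; set v := dsubmx _.
have rowE e (s : 'rV_d) : (row_mx (const_mx e : 'rV_1) s *m
    (col_mx a v : 'cV_(1 + d))) 0 0 = e * a 0 0 + (s *m v) 0 0.
  by rewrite mul_row_col mxE; congr (_ + _); rewrite mxE big_ord1 mxE.
have -> : \sum_i (col_mx a v : 'cV_(1 + d)) i 0 ^+ 2 =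
    a 0 0 ^+ 2 + \sum_i v i 0 ^+ 2.
  rewrite big_split_ord big_ord1/= col_mxEu; congr (_ + _).
  by apply: eq_bigr => i _; rewrite col_mxEd.
set A := a 0 0 ^+ 2; set V := \sum_i _ => lAV.
have A0 : 0 <= A by exact: sqr_ge0.
have V0 : 0 <= V by apply: sumr_ge0 => i _; exact: sqr_ge0.
have lA0 : 0 <= `|l| * A by rewrite mulr_ge0.
have lV0 : 0 <= `|l| * V by rewrite mulr_ge0.
have lAE : `|l * A| = `|l| * A by rewrite normrM (ger0_norm A0).
have lVE : `|l * V| = `|l| * V by rewrite normrM (ger0_norm V0).
pose k := l * (1 + 2 * (l * A)).
(* The induction hypothesis still applies to [k]: as [2 * (|l| * V) <= 1], the increase
   [2 * (|l| * A) * (|l| * V)] is at most [|l| * A]. *)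
have kV : `|k| * V <= 2 / 9.
  have : `|1 + 2 * (l * A)| <= 1 + 2 * (`|l| * A).
    rewrite (le_trans (ler_normD _ _))// normr1 normrM (@ger0_norm _ 2)//.
    by rewrite lAE.
  rewrite /k normrM mulrAC => /(ler_wpM2l lV0) /le_trans; apply; nra.
apply: (@le_trans _ _ (expR (l * A) *
    signmean (fun s => expR (k * (s *m v) 0 0 ^+ 2)))).
  rewrite /= -signmeanD mulrC -!signmeanZ; apply: signmean_le => s.
  rewrite !rowE mul1r mulN1r.
  set t := (s *m v) 0 0; set b := a 0 0.
  have -> : l * (b + t) ^+ 2 = l * t ^+ 2 + l * A + 2 * l * t * b.
    by rewrite /A -/b; ring.
  have -> : l * (- b + t) ^+ 2 = l * t ^+ 2 + l * A + - (2 * l * t * b).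
    by rewrite /A -/b; ring.
  have -> : k * t ^+ 2 = l * t ^+ 2 + (2 * l * t * b) ^+ 2 / 2.
    by rewrite /k /A -/b; field.
  have -> : expR (l * A) * expR (l * t ^+ 2 + (2 * l * t * b) ^+ 2 / 2) =
      expR (l * t ^+ 2 + l * A) * expR ((2 * l * t * b) ^+ 2 / 2).
    by rewrite -!expRD; congr expR; ring.
  rewrite !(expRD (l * t ^+ 2 + l * A)) -mulrDr mulrCA ler_pM2l ?expR_gt0//.
  by rewrite mulrC cosh_le_expR.
apply: (@le_trans _ _ (expR (l * A) * expR (k * V + 9 / 4 * (k * V) ^+ 2))).
  by rewrite ler_pM2l ?expR_gt0// IH.
rewrite -expRD ler_expR /k.
have AV0 : 0 <= (l * A) * (l * V).
  by rewrite mulrACA -expr2 mulr_ge0 ?sqr_ge0// mulr_ge0.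
have [lA lV] : `|l * A| <= 2 / 9 /\ `|l * V| <= 2 / 9.
  by rewrite lAE lVE; split; nra.
rewrite [l * (1 + _) * V]mulrAC (mulrDr l A V).
move: (l * A) (l * V) AV0 lA lV => x y xy; rewrite !ler_norml.
move=> /andP[x1 x2] /andP[y1 y2].
(* After expansion the goal is [9 * (x * y) * (y * (1 + x)) <= 9 / 4 * x ^+ 2 + 5 / 2 * (x * y)];
   since [0 <= x * y], the bound 5/18 suffices. *)
have y1x : y * (1 + x) <= 5 / 18.
  have : 0 <= (2 / 9 - y) * (1 + x) by apply: mulr_ge0; lra.
  lra.
have : x * y * (y * (1 + x)) <= x * y * (5 / 18) by rewrite ler_wpM2l.
nra.
Qed.

(** Averaging the tangent-line bounds at [M] cancels the linear terms. *)
Lemma expR_convex (p q a b : R) : 0 <= p -> 0 <= q -> p + q = 1 ->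
  expR (p * a + q * b) <= p * expR a + q * expR b.
Proof.
move=> p0 q0 pq; set M := p * a + q * b.
have tangent x : expR M * (1 + (x - M)) <= expR x.
  have {2}-> : x = M + (x - M) by ring.
  by rewrite (expRD M) ler_pM2l ?expR_gt0// expR_ge1Dx.
have := lerD (ler_wpM2l p0 (tangent a)) (ler_wpM2l q0 (tangent b)).
suff -> : p * (expR M * (1 + (a - M))) + q * (expR M * (1 + (b - M))) = expR M.
  by [].
transitivity (expR M * ((p + q) * (1 - M) + (p * a + q * b))); first by ring.
by rewrite pq mul1r -/M subrK mulr1.
Qed.

(** This is [signmean_expR_sqr] at [l / p], whose linear term the centering cancels. The factor [p]
    on both sides covers [w = 0]. *)
Lemma signmean_expR_sqr_centered d (w : 'cV[R]_d) (l p : R) :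
  \sum_i w i 0 ^+ 2 = p -> `|l| <= 2 / 9 ->
  p * signmean (fun s => expR (l * ((s *m w) 0 0 ^+ 2 / p - 1))) <=
  p * expR (9 / 4 * l ^+ 2).
Proof.
move=> wp l9; have : 0 <= p.
  by rewrite -wp; apply: sumr_ge0 => i _; exact: sqr_ge0.
rewrite le_eqVlt => /predU1P[<-|p0]; first by rewrite !mul0r.
rewrite ler_pM2l//.
rewrite (@eq_signmean _ _ (fun s =>
    expR (- l) * expR (l / p * (s *m w) 0 0 ^+ 2))); last first.
  by move=> s; rewrite -expRD; congr expR; field; rewrite gt_eqF.
rewrite signmeanZ expRN ler_pdivrMl ?expR_gt0// -expRD.
have := @signmean_expR_sqr _ w (l / p).
rewrite wp divfK ?gt_eqF//; apply.
by rewrite normrM normfV (gtr0_norm p0) divfK ?gt_eqF.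
Qed.

(* Polarization: <s, u><s, v> - <u, v> is p a - q b, with p + q = 1, where a and
   b are the centered squares of <s, (u + v) / 2> / sqrt p and
   <s, (u - v) / 2> / sqrt q; convexity of exp separates the two. *)
Lemma signmean_expR_chaos d (u v : 'cV[R]_d) (l : R) :
  \sum_i u i 0 ^+ 2 = 1 -> \sum_i v i 0 ^+ 2 = 1 -> `|l| <= 2 / 9 ->
  signmean (fun s =>
    expR (l * ((s *m u) 0 0 * (s *m v) 0 0 - \sum_i u i 0 * v i 0))) <=
  expR (9 / 4 * l ^+ 2).
Proof.
move=> u1 v1 l9; set rho := \sum_i _.
pose half (e : R) := 2^-1 *: (u + e *: v).
have halfE e : e ^+ 2 = 1 ->
    \sum_i half e i 0 ^+ 2 = (1 + e * rho) / 2.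
  move=> e1; have -> : (1 + e * rho) / 2 = 4^-1 * ((\sum_i u i 0 ^+ 2 +
      e ^+ 2 * \sum_i v i 0 ^+ 2) + 2 * e * rho).
    by rewrite u1 v1 e1; field.
  rewrite /rho !mulr_sumr -!big_split/= mulr_sumr; apply: eq_bigr => i _.
  by rewrite !mxE; field.
pose p := (1 + 1 * rho) / 2; pose q := (1 + - 1 * rho) / 2.
have wp : \sum_i half 1 i 0 ^+ 2 = p by apply: halfE; ring.
have wq : \sum_i half (-1) i 0 ^+ 2 = q by apply: halfE; ring.
have p0 : 0 <= p by rewrite -wp; apply: sumr_ge0 => i _; exact: sqr_ge0.
have q0 : 0 <= q by rewrite -wq; apply: sumr_ge0 => i _; exact: sqr_ge0.
(* If [u = - v] or [u = v], then [p] or [q] is 0 and division by it returns 0; [pK] and [qK] survive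
   because the corresponding half vector vanishes. *)
have sq0 e s : \sum_i half e i 0 ^+ 2 = 0 -> (s *m half e) 0 0 = 0.
  move=> /psumr_eq0P h; rewrite mxE big1// => i _.
  have /eqP := h (fun j _ => sqr_ge0 _) i isT.
  by rewrite sqrf_eq0 => /eqP ->; rewrite mulr0.
have pK s : p * ((s *m half 1) 0 0 ^+ 2 / p - 1) = (s *m half 1) 0 0 ^+ 2 - p.
  have [pz|pz] := eqVneq p 0; last by field.
  by rewrite sq0 ?wp// pz expr0n/= !mul0r subr0.
have qK s : q * ((s *m half (-1)) 0 0 ^+ 2 / q - 1) =
    (s *m half (-1)) 0 0 ^+ 2 - q.
  have [qz|qz] := eqVneq q 0; last by field.
  by rewrite sq0 ?wq// qz expr0n/= !mul0r subr0.
(* The minus sign before [q] moves into [- l], harmless since the final bound is even in [l]. *)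
apply: (@le_trans _ _ (signmean (fun s =>
    p * expR (l * ((s *m half 1) 0 0 ^+ 2 / p - 1)) +
    q * expR (- l * ((s *m half (-1)) 0 0 ^+ 2 / q - 1))))).
  apply: signmean_le => s.
  apply: le_trans (expR_convex _ _ _ _ p0 q0 _); last by rewrite /p /q; field.
  rewrite ler_expR (mulrCA p) (mulrCA q) pK qK.
  have halfM e : (s *m half e) 0 0 =
      2^-1 * ((s *m u) 0 0 + e * (s *m v) 0 0).
    by rewrite /half -scalemxAr mulmxDr -scalemxAr !mxE.
  by rewrite !halfM /p /q le_eqVlt; apply/orP; left; apply/eqP; field.
rewrite signmeanD !signmeanZ.
have -> : expR (9 / 4 * l ^+ 2) =
    p * expR (9 / 4 * l ^+ 2) + q * expR (9 / 4 * (- l) ^+ 2).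
  have pq : p + q = 1 by rewrite /p /q; field.
  by rewrite sqrrN -mulrDl pq mul1r.
by rewrite lerD// signmean_expR_sqr_centered ?normrN.
Qed.

(** Method of conditional expectations: each new vector keeps the weighted sum of exponentials at or
    below its mean, so the sum, initially [#|I|], grows by a factor of at most [C]. *)
Lemma signmean_select d (I : finType) (Y : I -> 'rV[R]_d -> R) (C : R)
    (r : nat) :
  0 <= C -> (forall i, signmean (fun s => expR (Y i s)) <= C) ->
  exists S : nat -> 'rV[R]_d,
    \sum_i expR (\sum_(k < r) Y i (S k)) <= #|I|%:R * C ^+ r.
Proof.
move=> C0 YC; elim: r => [|r [S IH]].
  exists (fun=> 0); rewrite mulr1 (eq_bigr (fun=> 1)) ?sumr_const ?cardE//.
  by move=> i _; rewrite big_ord0 expR0.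
pose P i := expR (\sum_(k < r) Y i (S k)).
have [s sP] := signmean_witness _ (fun s => \sum_i P i * expR (Y i s)).
exists (fun k => if (k < r)%N then S k else s).
have -> : \sum_i expR (\sum_(k < r.+1) Y i (if (k < r)%N then S k else s)) =
    \sum_i P i * expR (Y i s).
  apply: eq_bigr => i _; rewrite big_ord_recr/= ltnn expRD; congr (expR _ * _).
  by apply: eq_bigr => k _; rewrite ltn_ord.
rewrite (le_trans sP)// signmean_sum exprS mulrCA.
apply: le_trans (ler_wpM2l C0 IH); rewrite mulr_sumr; apply: ler_sum => i _.
by rewrite signmeanZ mulrC ler_wpM2r// expR_ge0.
Qed.

End SignMean.

(** * Gram factorization of the kernel *)

(** Cholesky factorization: the top-left entry is positive and its Schur complement is again
    positive definite. *)
Lemma posdefmx_gram {R : realType} n (A : 'M[R]_n) :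
  posdefmx A -> exists V : 'M[R]_n, A = V *m V^T.
Proof.
elim: n A => [|n IH] A; first by move=> _; exists 0; apply/matrixP => -[].
rewrite -[A](@submxK R 1 n 1 n).
set a := @ulsubmx R 1 n 1 n A; set b := @ursubmx R 1 n 1 n A.
set b' := @dlsubmx R 1 n 1 n A; set D := @drsubmx R 1 n 1 n A => -[symA posA].
have [_ _ b'E DE] := eq_block_mx (etrans (esym (tr_block_mx a b b' D)) symA).
have quadE (x : 'M[R]_1) (y : 'rV_n) :
    (row_mx x y : 'rV_(1 + n)) *m block_mx a b b' D *m (row_mx x y)^T =
    (x *m a + y *m b') *m x^T + (x *m b + y *m D) *m y^T.
  by rewrite mul_row_block tr_row_mx mul_row_col.
set c := a 0 0.
have c0 : 0 < c.
  have /posA : row_mx (1%:M : 'M[R]_1) (0 : 'rV_n) != 0.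
    by rewrite row_mx_eq0 negb_and oner_eq0.
  by rewrite quadE !mul0mx !addr0 trmx0 mulmx0 addr0 mul1mx trmx1 mulmx1.
have aE : a = c%:M by rewrite [LHS]mx11_scalar.
have [] := IH (D - c^-1 *: (b' *m b)).
  split; first by rewrite linearB linearZ/= trmx_mul DE -b'E trmxK.
  (* This first coordinate kills the first summand of [quadE], leaving the form of the Schur
     complement at [y]. *)
  move=> y y0; have /posA : row_mx (- c^-1 *: (y *m b')) y != 0.
    by rewrite row_mx_eq0 negb_and y0 orbT.
  rewrite quadE aE mul_mx_scalar scalerA mulrN divff ?gt_eqF// scaleN1r addNr.
  rewrite mul0mx add0r -scalemxAl scaleNr addrC -mulmxA scalemxAr.
  by rewrite -mulmxBr.
move=> V DV; exists (block_mx (Num.sqrt c)%:M 0 ((Num.sqrt c)^-1 *: b') V).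
have sc0 : Num.sqrt c != 0 by rewrite gt_eqF// sqrtr_gt0.
have scE : Num.sqrt c * Num.sqrt c = c by rewrite -expr2 sqr_sqrtr// ltW.
rewrite (@tr_block_mx _ 1 n 1 n) (@mulmx_block _ 1 n 1 n 1 n).
rewrite !trmx0 !mulmx0 !mul0mx !addr0 tr_scalar_mx linearZ/= -b'E trmxK.
rewrite -scalar_mxM scE -aE mul_scalar_mx scalerA divff// scale1r.
rewrite mul_mx_scalar scalerA divff// scale1r b'E -DV.
rewrite -scalemxAl -scalemxAr scalerA -invfM scE addrC subrK.
by rewrite -b'E.
Qed.

(** The kernel hypothesis concerns distinct points, so repetitions in [s] are removed; [phi x] is
    the row of the Gram factor at the position of [x], and 0 off the list. *)
Lemma positive_definite_kernel_gram {R : realType} m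
    (f : 'rV[R]_m -> 'rV[R]_m -> R) (s : seq 'rV[R]_m) :
  positive_definite_kernel f ->
  exists d (phi : 'rV[R]_m -> 'cV[R]_d),
    {in s &, forall x y, f x y = \sum_i phi x i 0 * phi y i 0}.
Proof.
move=> [_ fpos]; have [t0|t0] := posnP (size (undup s)).
  exists 0%N, (fun=> 0) => x y.
  by rewrite -mem_undup (size0nil t0).
pose z (i : 'I_(size (undup s))) := nth 0 (undup s) i.
have z_inj : injective z.
  move=> i j /eqP; rewrite nth_uniq ?undup_uniq// => /eqP ij; exact: val_inj.
have [V fV] := posdefmx_gram _ _ (fpos _ z t0 z_inj).
exists (size (undup s)), (fun x => \col_k
  if insub (index x (undup s)) is Some i then V i k else 0) => x y xs ys.
rewrite -mem_undup -index_mem in xs; rewrite -mem_undup -index_mem in ys.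
have := congr1 (fun M : 'M[R]_(size (undup s)) =>
   M (Ordinal xs) (Ordinal ys)) fV.
rewrite !mxE /z/= !nth_index -?index_mem// => ->; apply: eq_bigr => k _.
by rewrite !mxE !insubT.
Qed.

(* The norm `| F - G | of a matrix is the library's entrywise max norm. *)
Theorem theorem5p2 (R : realType) (eps : R) (n1 n2 m r : nat)
    (f : 'rV[R]_m -> 'rV[R]_m -> R) (kappa : 'rV[R]_m -> R) :
  0 < eps -> eps < 1 ->
  (0 < n1)%N -> (0 < n2)%N -> (0 < m)%N ->
  r%:Z = Num.ceil (9 * ln ((3 * n1 * n2)%N%:R : R) / eps ^+ 2) ->
  continuous (fun p : 'rV[R]_m * 'rV[R]_m => f p.1 p.2) ->
  shift_invariant_via f kappa ->
  positive_definite_kernel f ->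
  kappa 0 = 1 ->
  forall (F : 'M[R]_(n1, n2)) (x : 'I_n1 -> 'rV[R]_m) (y : 'I_n2 -> 'rV[R]_m),
    (forall i j, F i j = f (x i) (y j)) ->
    exists G : 'M[R]_(n1, n2), (\rank G <= r)%N /\ `|F - G| <= eps.
Proof.
move=> eps0 eps1 n1_gt0 n2_gt0 _ rE _ fkappa fpos kappa0 F x y FE.
have N_gt1 : (1 < 3 * n1 * n2)%N.
  by rewrite -mulnA (@leq_trans 3)// leq_pmulr// muln_gt0 n1_gt0.
set L := ln _ in rE.
have N0 : 0 < (3 * n1 * n2)%N%:R :> R by rewrite ltr0n ltnW.
have expL : expR L = (3 * n1 * n2)%N%:R by rewrite lnK// posrE.
have L0 : 0 < L by rewrite ln_gt0// ltr1n.
have eps2 : 0 < eps ^+ 2 by rewrite exprn_gt0.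
have r0 : 0 < r%:R :> R.
  have : 0 < r%:Z by rewrite rE ceil_gt0 divr_gt0// mulr_gt0.
  by rewrite ltr0n.
have Lr : L <= r%:R * (eps ^+ 2 / 9).
  have := ceil_ge (9 * L / eps ^+ 2); rewrite -rE -pmulrn.
  by rewrite ler_pdivrMr// => ?; lra.
(* Row and column points are embedded jointly: [F] is an off-diagonal block of the joint kernel
   matrix. *)
have [d [phi phiE]] :=
  positive_definite_kernel_gram _ f (codom x ++ codom y) fpos.
have xin i : x i \in codom x ++ codom y by rewrite mem_cat codom_f.
have yin j : y j \in codom x ++ codom y by rewrite mem_cat codom_f orbT.
have unit_phi p : p \in codom x ++ codom y -> \sum_k phi p k 0 ^+ 2 = 1.
  by move=> ps; rewrite -kappa0 -(subrr p) -fkappa phiE.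
pose X i j (s : 'rV[R]_d) := (s *m phi (x i)) 0 0 * (s *m phi (y j)) 0 0.
(* This [l] minimizes [9 / 4 * l ^+ 2 - l * eps], and [eps < 1] keeps it below 2/9. *)
pose l := 2 / 9 * eps.
pose Y (ijb : 'I_n1 * 'I_n2 * bool) (s : 'rV[R]_d) :=
  (-1) ^+ ijb.2 * l * (X ijb.1.1 ijb.1.2 s - F ijb.1.1 ijb.1.2).
have l0 : 0 < l by rewrite mulr_gt0// divr_gt0.
have Ymean ijb : signmean (fun s => expR (Y ijb s)) <= expR (eps ^+ 2 / 9).
  case: ijb => [[i j] b]; rewrite /Y/= FE (phiE _ _ (xin i) (yin j)).
  have -> : eps ^+ 2 / 9 = 9 / 4 * ((-1) ^+ b * l) ^+ 2.
    by rewrite exprMn sqrr_sign mul1r /l; field.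
  apply: signmean_expR_chaos; rewrite ?unit_phi//.
  by rewrite normrM normr_sign mul1r gtr0_norm// /l; lra.
have [S SY] := signmean_select _ _ Y _ r (expR_ge0 _) Ymean.
have dev i j (b : bool) :
    (-1) ^+ b * l * (\sum_(k < r) X i j (S k) - r%:R * F i j) <=
    l * (r%:R * eps).
  have -> : (-1) ^+ b * l * (\sum_(k < r) X i j (S k) - r%:R * F i j) =
      \sum_(k < r) Y (i, j, b) (S k).
    by rewrite -mulr_sumr sumrB sumr_const card_ord mulr_natl.
  (* One exponential is at most the whole sum, whose index set has [2 * n1 * n2 <= expR L] elements.
     By [Lr] both summands are at most half of [l * (r * eps)]. *)
  apply: (@le_trans _ _ (L + r%:R * (eps ^+ 2 / 9))); last by rewrite /l; lra.
  rewrite -ler_expR expRD expRM_natl expL.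
  apply: (le_trans _ (le_trans SY _)).
    rewrite (bigD1 (i, j, b))//= lerDl.
    by apply: sumr_ge0 => ? _; exact: expR_ge0.
  rewrite ler_wpM2r ?exprn_ge0 ?expR_ge0// ler_nat.
  by rewrite !card_prod !card_ord card_bool mulnC mulnA !leq_mul.
pose P := \matrix_(i < n1, k < r) (S k *m phi (x i)) 0 0.
pose Q := \matrix_(k < r, j < n2) (S k *m phi (y j)) 0 0.
(* The average of the rank-one matrices factors through dimension [r]. *)
exists ((r%:R^-1 *: P) *m Q); split; first exact: mulmx_max_rank.
rewrite [leLHS]mx_normrE; apply: bigmax_le => [|[i j] _]; first exact: ltW.
have -> : (F - (r%:R^-1 *: P) *m Q) i j =
    - (r%:R^-1 * (\sum_(k < r) X i j (S k) - r%:R * F i j)).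
  rewrite !mxE mulrBr mulKf ?gt_eqF// opprB; congr (_ - _).
  rewrite mulr_sumr; apply: eq_bigr => k _.
  by rewrite mxE [P i k]mxE [Q k j]mxE mulrA.
rewrite normrN normrM normfV (gtr0_norm r0) ler_pdivrMl//.
rewrite ler_norml -lerNl.
have := dev i j true; have := dev i j false.
by rewrite expr0 expr1 mul1r mulN1r mulNr -mulrN !ler_pM2l// => -> ->.
Qed.
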